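(* (1) There exist recursive sets $A,B$ such that $A\le_T^{SN}B$ and $A\not\le_T^{O}B$; indeed, this can be achieved with $B$ a recursive sparse set and $A$ a recursive tally set. (2) There exist recursive sets $A,B$ such that $A\le_T^{SN}B$ and $A\not\le_T^{U}B$; indeed, this can be achieved with $B$ a recursive sparse set and $A$ a recursive tally set.
   Context: Sets are languages over $\{0,1\}$. A set $S$ is sparse if there is a polynomial $r$ with $|S\cap\Sigma^{\le n}|\le r(n)$ for all $n$; a tally set is a subset of $\{0\}^*$. An NPTM is a nondeterministic oracle Turing machine $N$ each of whose computation paths ends in one of three outcomes $\mathbf{acc}$, $\mathbf{rej}$, $\mathbf{?}$, such that there is a polynomial $p$ with: for every oracle $D$ and every input $x$, every computation path of $N^D(x)$ has length at most $p(|x|)$. For an oracle $D$ and input $x$, let $out_{N^D}(x)$ be the set of outcomes occurring on some path of $N^D(x)$; $L(N^D)=\{x:\mathbf{acc}\in out_{N^D}(x)\}$. $N^D(x)$ is underproductive if $\{\mathbf{acc},\mathbf{rej}\}\not\subseteq out_{N^D}(x)$, and overproductive if $out_{N^D}(x)\neq\{\mathbf{?}\}$; $N^D$ is underproductive (overproductive) if $N^D(x)$ is so for every $x$. $N$ is robustly underproductive (overproductive) if $N^D$ is underproductive (overproductive) for every oracle $D$. $A\le_T^{SN}B$ if there is an NPTM $N$ with $N^B$ both overproductive and underproductive and $A=L(N^B)$. $A\le_T^{U}B$ if $A\le_T^{SN}B$ via an $N$ that is robustly underproductive. $A\le_T^{O}B$ if $A\le_T^{SN}B$ via an $N$ that is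 robustly overproductive. *)

(* Defs.v *)
From HB Require Import structures.
From mathcomp Require Import all_boot ssralg poly.
From mathcomp Require Import boolp classical_sets functions cardinality.

Set Implicit Arguments.
Unset Strict Implicit.
Unset Printing Implicit Defensive.

Local Open Scope classical_set_scope.
Local Open Scope card_scope.

(** [false] is the letter 0 and [true] is the letter 1. *)
Notation word := (seq bool) (only parsing).
Notation language := (set word) (only parsing).

(** The recursive total functions in the sense of Kleene: the least class that
    contains the constant 0, the successor and the projections, and is closed
    under composition, primitive recursion and regular minimization. *)
Inductive recursive_fun : forall k : nat, (k.-tuple nat -> nat) -> Prop :=
| rec_zero k : recursive_fun (fun _ : k.-tuple nat => 0)
| rec_succ : recursive_fun (fun v : 1.-tuple nat => (thead v).+1)
| rec_proj k (i : 'I_k) : recursive_fun (fun v : k.-tuple nat => tnth v i)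
| rec_comp k m (f : m.-tuple nat -> nat) (g : 'I_m -> k.-tuple nat -> nat) :
    recursive_fun f -> (forall i, recursive_fun (g i)) ->
    recursive_fun (fun v : k.-tuple nat => f [tuple g i v | i < m])
| rec_prim k (f : k.-tuple nat -> nat) (g : k.+2.-tuple nat -> nat)
    (h : k.+1.-tuple nat -> nat) :
    recursive_fun f -> recursive_fun g ->
    (forall v : k.-tuple nat, h [tuple of 0 :: v] = f v) ->
    (forall n (v : k.-tuple nat), h [tuple of n.+1 :: v] =
       g [tuple of n :: h [tuple of n :: v] :: v]) ->
    recursive_fun h
| rec_min k (f : k.+1.-tuple nat -> nat) (h : k.-tuple nat -> nat) :
    recursive_fun f ->
    (forall v : k.-tuple nat, f [tuple of h v :: v] = 0 /\
       forall n, n < h v -> f [tuple of n :: v] <> 0) ->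
    recursive_fun h.

(** The number whose binary expansion is [1w]. *)
Definition word_code (w : word) : nat := foldl (fun n (b : bool) => n.*2 + b) 1 w.

Definition recursive_set (S : language) : Prop :=
  exists2 f : 1.-tuple nat -> nat, recursive_fun f &
    forall w : word, f [tuple word_code w] = `[< S w >].

(** Polynomial bounds are polynomials with coefficients in [nat]; every
    polynomial bound on [nat] is dominated by one of these. *)
Definition sparse_set (S : language) : Prop :=
  exists r : {poly nat}, forall n : nat,
    S `&` [set w | size w <= n] #<= `I_(r.[n])%R.

Definition tally_set (S : language) : Prop :=
  S `<=` [set nseq n false | n in [set: nat]].

(** Nondeterministic oracle Turing machines with one two-way infinite work tape,
    which initially holds the input, and one append-only query tape, which is
    erased by each query.  Symbols and states are natural numbers; a machine is a
    finite table, so it uses only finitely many of them. *)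
Notation symbol := nat (only parsing).
Definition blank : symbol := 0.
Definition bit_symbol (b : bool) : symbol := b.+1.

Variant outcome := Acc | Rej | Unk.

Notation state := nat (only parsing).
Definition q_start : state := 0.
Definition q_query : state := 1.
Definition q_yes : state := 2.
Definition q_no : state := 3.
Definition q_halt (o : outcome) : state :=
  match o with Acc => 4 | Rej => 5 | Unk => 6 end.

Variant move := Left | Stay | Right.

Definition move_to_ord (m : move) : 'I_3 :=
  match m with Left => inord 0 | Stay => inord 1 | Right => inord 2 end.
Definition ord_to_move (i : 'I_3) : move := nth Left [:: Left; Stay; Right] i.
Lemma move_to_ordK : cancel move_to_ord ord_to_move.
Proof. by case; rewrite /ord_to_move inordK. Qed.
HB.instance Definition _ := Countable.copy move (can_type move_to_ordK).

(** [((q, a), (q', b, m, u))]: in state [q] reading [a], go to state [q'],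
    write [b], move the head by [m] and, if [u = Some c], append the letter [c]
    to the query tape. *)
Definition instruction : Type :=
  ((state * symbol) * (state * symbol * move * option bool))%type.

Notation machine := (seq instruction) (only parsing).

(** [(l, r)]: [r] is the tape from the scanned cell to the right, and [l] is the
    tape to the left of it, read from right to left; all further cells are blank. *)
Notation tape := (seq symbol * seq symbol)%type (only parsing).

Definition scanned (t : tape) : symbol := head blank t.2.

Definition write_move (b : symbol) (m : move) (t : tape) : tape :=
  let: (l, r) := t in
  match m with
  | Left => (behead l, head blank l :: b :: behead r)
  | Stay => (l, b :: behead r)
  | Right => (b :: l, behead r)
  end.

Record config := Config { cstate : state; ctape : tape; cquery : word }.

Definition initial (x : word) : config :=
  Config q_start ([::], map bit_symbol x) [::].

Definition halted (c : config) : Prop := exists o, cstate c = q_halt o.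

Inductive step (N : machine) (D : language) : config -> config -> Prop :=
| step_yes t w : D w -> step N D (Config q_query t w) (Config q_yes t [::])
| step_no t w : ~ D w -> step N D (Config q_query t w) (Config q_no t [::])
| step_instr q t w q' b m u :
    q <> q_query -> (forall o, q <> q_halt o) ->
    ((q, scanned t), (q', b, m, u)) \in N ->
    step N D (Config q t w)
      (Config q' (write_move b m t) (if u is Some c then rcons w c else w)).

(** [steps N D k c c']: some computation path of length [k] leads from [c] to [c']. *)
Fixpoint steps (N : machine) (D : language) (k : nat) (c c' : config) : Prop :=
  if k is k'.+1 then exists2 d, step N D c d & steps N D k' d c' else c = c'.

(** The polynomial bound excludes infinite paths, so the final disjunction means
    that every path ends, within the bound, in one of the three outcomes. *)
Definition nptm (N : machine) : Prop :=
  exists p : {poly nat}, forall (D : language) (x : word) (k : nat) (c : config),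
    steps N D k (initial x) c ->
    k <= p.[size x]%R /\ (halted c \/ exists d, step N D c d).

Definition out (N : machine) (D : language) (x : word) : set outcome :=
  [set o | exists k c, steps N D k (initial x) c /\ cstate c = q_halt o].

Definition lang (N : machine) (D : language) : language :=
  [set x | out N D x Acc].

Definition underproductive (N : machine) (D : language) : Prop :=
  forall x, ~ ([set Acc; Rej] `<=` out N D x).

Definition overproductive (N : machine) (D : language) : Prop :=
  forall x, out N D x <> [set Unk].

Definition robustly_underproductive (N : machine) : Prop :=
  forall D, underproductive N D.

Definition robustly_overproductive (N : machine) : Prop :=
  forall D, overproductive N D.

Definition SN_via (N : machine) (A B : language) : Prop :=
  [/\ nptm N, overproductive N B, underproductive N B & A = lang N B].

Definition SN_reducible (A B : language) : Prop := exists N, SN_via N A B.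

Definition U_reducible (A B : language) : Prop :=
  exists2 N, SN_via N A B & robustly_underproductive N.

Definition O_reducible (A B : language) : Prop :=
  exists2 N, SN_via N A B & robustly_overproductive N.

(* Main.v *)
Require Import Defs.
From HB Require Import structures.
From mathcomp Require Import all_boot ssralg poly.
From mathcomp Require Import boolp classical_sets functions cardinality.
From mathcomp Require Import zify.

Set Implicit Arguments.
Unset Strict Implicit.
Unset Printing Implicit Defensive.

(** One pair [A], [B] serves for both parts.  [B] contains exactly one word of every
    positive length, and [0^n] is in [A] iff the word of length [n.+1] ends in 1; guessing
    that word gives [A <=SN B].  By default the word of length [m] is [0^m].  Only the
    lengths [t i + 1], where [t 0 = 1] and [t i.+1 = 2 ^ t i], are used to diagonalize: with
    [n = t i], stage [i] takes the machine [N] numbered [i] and chooses, if there is one, a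
    word [v] of length [n.+1] with which [N] on [0^n], simulated for [2 ^ n] steps, either
    accepts when the last letter of [v] is 0 or fails to accept when it is 1, or likewise
    for rejection with the two letters exchanged.  The lengths grow so fast that later
    stages do not disturb the simulation once the time bound of [N] is below [2 ^ n].  Every
    machine is treated at infinitely many stages.

    If such a [v] is found, then [N] does not reduce [A] to [B].  Otherwise [N] is correct
    for all [v].  Then without any word of length [n.+1] it has neither an accepting nor a
    rejecting path, because such a path would survive adding an unqueried word that makes it
    wrong: [N] is not robustly overproductive.  And for some pair [w0], [w'1] of added words
    the rejecting path for [w0] does not query [w'1] and the accepting path for [w'1] does
    not query [w0], so both paths coexist in the oracle containing both words: [N] is not
    robustly underproductive. *)

(** * Recursive functions on coded data *)

Lemma recursive_ext k (F G : k.-tuple nat -> nat) :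
  F =1 G -> recursive_fun F -> recursive_fun G.
Proof. by move=> /funext ->. Qed.

Lemma recursive_nth k i : i < k -> recursive_fun (fun v : k.-tuple nat => nth 0 v i).
Proof.
move=> ltik; apply: recursive_ext (rec_proj (Ordinal ltik)) => v.
by rewrite (tnth_nth 0).
Qed.

(** Arguments are read with [nth 0] rather than [tnth], so that no ordinal has to be built for a
    variable. *)
Definition rec1 (f : nat -> nat) : Prop :=
  recursive_fun (fun v : 1.-tuple nat => f (nth 0 v 0)).
Definition rec2 (f : nat -> nat -> nat) : Prop :=
  recursive_fun (fun v : 2.-tuple nat => f (nth 0 v 0) (nth 0 v 1)).

Lemma recursive_comp1 k f (F : k.-tuple nat -> nat) :
  rec1 f -> recursive_fun F -> recursive_fun (fun v => f (F v)).
Proof.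
move=> rf rF; apply: recursive_ext (rec_comp rf (fun _ : 'I_1 => rF)) => v.
by rewrite (nth_mktuple _ 0 ord0).
Qed.

Lemma recursive_comp2 k f (F G : k.-tuple nat -> nat) :
  rec2 f -> recursive_fun F -> recursive_fun G ->
  recursive_fun (fun v => f (F v) (G v)).
Proof.
move=> rf rF rG.
have rFG (i : 'I_2) : recursive_fun (if i == ord0 then F else G) by case: ifP.
apply: recursive_ext (rec_comp rf rFG) => v.
by rewrite (nth_mktuple _ 0 ord0) (nth_mktuple _ 0 ord_max).
Qed.

Lemma rec1_succ : rec1 succn.
Proof. by apply: recursive_ext rec_succ => v; rewrite /thead (tnth_nth 0). Qed.

Lemma rec2_iter g : rec1 g -> rec2 (fun n a => iter n g a).
Proof.
move=> rg; apply: (@rec_prim 1 (fun v => nth 0 v 0) (fun v => g (nth 0 v 1))) => //.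
  exact: recursive_nth.
by apply: recursive_comp1 => //; apply: recursive_nth.
Qed.

Lemma rec2_add : rec2 addn.
Proof.
by apply: recursive_ext (rec2_iter rec1_succ) => v /=; rewrite iter_succn addnC.
Qed.

Lemma rec1_pred : rec1 predn.
Proof.
apply: (@rec_prim 0 (fun=> 0) (fun v => nth 0 v 0)) => //.
  exact: rec_zero.
exact: recursive_nth.
Qed.

Lemma rec2_sub : rec2 subn.
Proof.
have := recursive_comp2 (rec2_iter rec1_pred)
  (@recursive_nth 2 1 isT) (@recursive_nth 2 0 isT).
by apply: recursive_ext => v /=; rewrite iter_predn.
Qed.

(** * Cantor pairing *)

Fixpoint triangle n := if n is m.+1 then triangle m + n else 0.

Lemma rec1_triangle : rec1 triangle.
Proof.
apply: (@rec_prim 0 (fun=> 0) (fun v => nth 0 v 1 + (nth 0 v 0).+1)) => //.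
  exact: rec_zero.
apply: recursive_comp2 rec2_add _ _; first exact: recursive_nth.
by apply: recursive_comp1 rec1_succ _; apply: recursive_nth.
Qed.

Lemma leq_triangle m n : m <= n -> triangle m <= triangle n.
Proof. by apply: (@homo_leq _ _ leq) => // [|k]; [exact: leq_trans|exact: leq_addr]. Qed.

(* The index of the antidiagonal of [nat * nat] that contains the [n]-th pair. *)
Fixpoint antidiag n :=
  if n is m.+1 then antidiag m + (1 - (triangle (antidiag m).+1 - n)) else 0.

Lemma rec1_antidiag : rec1 antidiag.
Proof.
apply: (@rec_prim 0 (fun=> 0) (fun v => nth 0 v 1 +
  (1 - (triangle (nth 0 v 1).+1 - (nth 0 v 0).+1)))) => //.
  exact: rec_zero.
apply: recursive_comp2 rec2_add _ _; first exact: recursive_nth.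
apply: recursive_comp2 rec2_sub _ _.
  by apply: recursive_comp1 rec1_succ _; exact: rec_zero.
apply: recursive_comp2 rec2_sub _ _.
  apply: recursive_comp1 rec1_triangle _.
  by apply: recursive_comp1 rec1_succ _; apply: recursive_nth.
by apply: recursive_comp1 rec1_succ _; apply: recursive_nth.
Qed.

(** The increment [1 - (triangle (antidiag n).+1 - n.+1)] is 1 exactly when [n.+1] has reached the
    next triangular number, so the index advances there and only there. *)
Lemma antidiagP n : triangle (antidiag n) <= n < triangle (antidiag n).+1.
Proof.
elim: n => // n /andP[IH1 IH2].
rewrite [antidiag n.+1]/=.
have [lt|le] := ltnP n.+1 (triangle (antidiag n).+1).
  have -> : antidiag n + (1 - (triangle (antidiag n).+1 - n.+1)) = antidiag n by lia.
  by rewrite lt andbT; lia.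
have -> : antidiag n + (1 - (triangle (antidiag n).+1 - n.+1)) = (antidiag n).+1 by lia.
by move: IH2 le => /=; lia.
Qed.

Definition npair x y := triangle (x + y) + y.
Definition nsnd n := n - triangle (antidiag n).
Definition nfst n := antidiag n - nsnd n.

(** As [triangle] is monotone, the intervals from one triangular number to the next are disjoint,
    and [antidiagP] determines the index. *)
Lemma antidiag_npair x y : antidiag (npair x y) = x + y.
Proof.
have := antidiagP (npair x y); have : npair x y = triangle (x + y) + y by [].
move: (npair x y) => n En; set a := antidiag n => /andP[le lt].
have [lt_a|lt_a|//] := ltngtP a (x + y).
  by have := leq_triangle lt_a; lia.
by have := leq_triangle lt_a => /=; lia.
Qed.

Lemma nsnd_pair x y : nsnd (npair x y) = y.
Proof. by rewrite /nsnd antidiag_npair addKn. Qed.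

Lemma nfst_pair x y : nfst (npair x y) = x.
Proof. by rewrite /nfst nsnd_pair antidiag_npair addnK. Qed.

Lemma npair_surj n : npair (nfst n) (nsnd n) = n.
Proof.
have /andP[] := antidiagP n.
by rewrite /npair /nfst /nsnd /= => le lt; rewrite subnK; lia.
Qed.

Lemma npair_ge x y : x <= npair x y /\ y <= npair x y.
Proof.
have le_triangle n : n <= triangle n by elim: n => // n _ /=; lia.
by rewrite /npair; have := le_triangle (x + y); lia.
Qed.

Lemma rec2_npair : rec2 npair.
Proof.
apply: recursive_comp2 rec2_add _ _; last exact: recursive_nth.
apply: recursive_comp1 rec1_triangle _.
by apply: recursive_comp2 rec2_add _ _; apply: recursive_nth.
Qed.

Lemma rec1_nsnd : rec1 nsnd.
Proof.
apply: recursive_comp2 rec2_sub _ _; first exact: recursive_nth.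
apply: recursive_comp1 rec1_triangle _.
exact: rec1_antidiag.
Qed.

Lemma rec1_nfst : rec1 nfst.
Proof. exact: recursive_comp2 rec2_sub rec1_antidiag rec1_nsnd. Qed.

Lemma rec1_const c : rec1 (fun=> c).
Proof.
elim: c => [|c IHc]; first exact: rec_zero.
exact: recursive_comp1 rec1_succ IHc.
Qed.

(** * Coded types and computable maps between them *)

(** Codes are injective but may miss numbers, as for [bool]. Surjectivity is the separate notion
    [code_onto], used to read every number as a stage. *)
Class coded (T : Type) := Coded { code : T -> nat; code_inj : injective code }.

#[export] Instance nat_coded : coded nat := Coded (@inj_id nat).

Lemma nat_of_bool_inj : injective nat_of_bool. Proof. by do 2!case. Qed.
#[export] Instance bool_coded : coded bool := Coded nat_of_bool_inj.

Section ProductCode.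
Context {T U : Type} {cT : coded T} {cU : coded U}.
Definition prod_code (z : T * U) := npair (code z.1) (code z.2).
Lemma prod_code_inj : injective prod_code.
Proof.
move=> [x y] [x' y']; rewrite /prod_code /= => E.
move: (congr1 nfst E) (congr1 nsnd E); rewrite !nfst_pair !nsnd_pair.
by move=> /(@code_inj T) -> /(@code_inj U) ->.
Qed.
#[export] Instance prod_coded : coded (T * U) := Coded prod_code_inj.
End ProductCode.

Section SeqCode.
Context {T : Type} {cT : coded T}.
Fixpoint seq_code (s : seq T) := if s is x :: s' then (npair (code x) (seq_code s')).+1 else 0.
Lemma seq_code_inj : injective seq_code.
Proof.
elim=> [|x s IHs] [|y s'] //= /eqP; rewrite eqSS => /eqP E.
move: (congr1 nfst E) (congr1 nsnd E); rewrite !nfst_pair !nsnd_pair.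
by move=> /(@code_inj T) -> /IHs ->.
Qed.
#[export] Instance seq_coded : coded (seq T) := Coded seq_code_inj.
(** This lets the code of a list serve as the number of iterations in a traversal of it. *)
Lemma size_seq_code s : size s <= seq_code s.
Proof. by elim: s => //= x s IHs; have [_] := npair_ge (code x) (seq_code s); lia. Qed.
End SeqCode.

Definition code_onto T {cT : coded T} := forall n, exists x : T, code x = n.

Lemma nat_code_onto : code_onto (T := nat).
Proof. by move=> n; exists n. Qed.

Lemma prod_code_onto T U {cT : coded T} {cU : coded U} :
  code_onto (T := T) -> code_onto (T := U) -> code_onto (T := T * U).
Proof.
move=> oT oU n; have [[x Ex] [y Ey]] := (oT (nfst n), oU (nsnd n)).
by exists (x, y); rewrite /= /prod_code /= Ex Ey npair_surj.
Qed.

Lemma seq_code_onto T {cT : coded T} : code_onto (T := T) -> code_onto (T := seq T).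
Proof.
move=> oT; elim/ltn_ind=> -[|n] IHn; first by exists [::].
have [x Ex] := oT (nfst n).
have [|s Es] := IHn (nsnd n).
  by have [_] := npair_ge (nfst n) (nsnd n); rewrite npair_surj.
by exists (x :: s); rewrite /= Ex; rewrite /= in Es; rewrite Es npair_surj.
Qed.

(** The function [F] is total on numbers but constrained on codes only, so operations on codes can
    be used without a validity test. *)
Definition computable {A B : Type} {cA : coded A} {cB : coded B} (f : A -> B) : Prop :=
  exists2 F, rec1 F & forall a, F (code a) = code (f a).

Section Computable.
Context {A : Type} {cA : coded A}.

Lemma computable_ext {B} {cB : coded B} (f g : A -> B) :
  f =1 g -> computable f -> computable g.
Proof. by move=> /funext ->. Qed.

Lemma computable_id : computable (fun a : A => a).
Proof. by exists id => //; apply: recursive_nth. Qed.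

Lemma computable_const {B} {cB : coded B} (b : B) : computable (fun _ : A => b).
Proof. by exists (fun=> code b) => //; apply: rec1_const. Qed.

Lemma computable_comp {B C} {cB : coded B} {cC : coded C} (g : B -> C) (f : A -> B) :
  computable g -> computable f -> computable (fun a => g (f a)).
Proof.
move=> [G rG EG] [F rF EF]; exists (fun n => G (F n)); first exact: recursive_comp1 rG rF.
by move=> a; rewrite EF EG.
Qed.

Lemma computable_pair {B C} {cB : coded B} {cC : coded C} (f : A -> B) (g : A -> C) :
  computable f -> computable g -> computable (fun a => (f a, g a)).
Proof.
move=> [F rF EF] [G rG EG]; exists (fun n => npair (F n) (G n)).
  exact: recursive_comp2 rec2_npair rF rG.
by move=> a; rewrite EF EG.
Qed.

Lemma computable_fst {B C} {cB : coded B} {cC : coded C} (f : A -> B * C) :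
  computable f -> computable (fun a => (f a).1).
Proof.
apply: computable_comp; exists nfst; first exact: rec1_nfst.
by move=> [b c]; rewrite /= /prod_code nfst_pair.
Qed.

Lemma computable_snd {B C} {cB : coded B} {cC : coded C} (f : A -> B * C) :
  computable f -> computable (fun a => (f a).2).
Proof.
apply: computable_comp; exists nsnd; first exact: rec1_nsnd.
by move=> [b c]; rewrite /= /prod_code nsnd_pair.
Qed.

Lemma computable_rec1 F (f : A -> nat) : rec1 F -> computable f -> computable (fun a => F (f a)).
Proof. by move=> rF; apply: computable_comp; exists F. Qed.

Lemma computable_rec2 F (f g : A -> nat) :
  rec2 F -> computable f -> computable g -> computable (fun a => F (f a) (g a)).
Proof.
move=> rF [f' rf Ef] [g' rg Eg]; exists (fun n => F (f' n) (g' n)).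
  exact: recursive_comp2 rF rf rg.
by move=> a; rewrite Ef Eg.
Qed.

Lemma computable_code {B} {cB : coded B} (f : A -> B) :
  computable f -> computable (fun a => code (f a)).
Proof. by case=> F rF EF; exists F. Qed.

Lemma computable_uncode {B} {cB : coded B} (f : A -> B) :
  computable (fun a => code (f a)) -> computable f.
Proof. by case=> F rF EF; exists F. Qed.

(** [rec2_iter] iterates a map without parameters, so the code of [a] is carried along as the first
    component of the state. *)
Lemma computable_iter {S} {cS : coded S} (n : A -> nat) (h : A -> S -> S) (s : A -> S) :
  computable n -> computable (fun z : A * S => h z.1 z.2) -> computable s ->
  computable (fun a => iter (n a) (h a) (s a)).
Proof.
move=> [n' rn En] [h' rh Eh] [s' rs Es].
pose g z := npair (nfst z) (h' z).
have rg : rec1 g by apply: recursive_comp2 rec2_npair _ rh; exact: rec1_nfst.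
exists (fun a => nsnd (iter (n' a) g (npair a (s' a)))).
  apply: recursive_comp1 rec1_nsnd _; apply: recursive_comp2 (rec2_iter rg) rn _.
  by apply: recursive_comp2 rec2_npair _ rs; apply: recursive_nth.
move=> a; rewrite En Es -[RHS](nsnd_pair (code a)); congr nsnd.
elim: (n a : nat) => //= m IHm; rewrite {}IHm {1}/g nfst_pair; congr npair.
exact: Eh (a, iter m (h a) (s a)).
Qed.

Lemma computable_nat_of_bool (b : A -> bool) :
  computable b -> computable (fun a => b a : nat).
Proof. exact: computable_code. Qed.

End Computable.

Ltac computable_projections :=
  solve [repeat first [exact: computable_id | apply: computable_fst | apply: computable_snd]].

Section Closure.
Context {A : Type} {cA : coded A}.

(** Branching is an iteration: the pair [(g a, f a)] is swapped [b a] times and its first component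
    is returned. *)
Lemma computable_if {B} {cB : coded B} (b : A -> bool) (f g : A -> B) :
  computable b -> computable f -> computable g ->
  computable (fun a => if b a then f a else g a).
Proof.
move=> cb cf cg.
have cz : computable (fun a => iter (b a) (fun z => (z.2, z.1)) (g a, f a)).
  apply: computable_iter (computable_nat_of_bool cb) _ (computable_pair cg cf).
  by apply: computable_pair; computable_projections.
by apply: computable_ext (computable_fst cz) => a; case: (b a).
Qed.

Lemma computable_succ (f : A -> nat) : computable f -> computable (fun a => (f a).+1).
Proof. exact: computable_rec1 rec1_succ. Qed.

Lemma computable_leq (f g : A -> nat) :
  computable f -> computable g -> computable (fun a => f a <= g a).
Proof.
move=> cf cg; apply: computable_uncode.
apply: (@computable_ext _ _ _ _ (fun a => 1 - (f a - g a))).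
  by move=> a /=; lia.
apply: computable_rec2 rec2_sub (computable_const 1) _.
exact: computable_rec2 rec2_sub cf cg.
Qed.

Lemma computable_and (b c : A -> bool) :
  computable b -> computable c -> computable (fun a => b a && c a).
Proof. by move=> cb cc; apply: computable_if cb cc (computable_const false). Qed.

Lemma computable_or (b c : A -> bool) :
  computable b -> computable c -> computable (fun a => b a || c a).
Proof. by move=> cb cc; apply: computable_if cb (computable_const true) cc. Qed.

Lemma computable_negb (b : A -> bool) : computable b -> computable (fun a => ~~ b a).
Proof.
by move=> cb; apply: computable_if cb (computable_const false) (computable_const true).
Qed.

Lemma computable_eq {T : eqType} {cT : coded T} (f g : A -> T) :
  computable f -> computable g -> computable (fun a => f a == g a).
Proof.
move=> cf cg.
apply: (@computable_ext _ _ _ _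
  (fun a => (code (f a) <= code (g a)) && (code (g a) <= code (f a)))).
  by move=> a; rewrite -eqn_leq (inj_eq code_inj).
by apply: computable_and; apply: computable_leq; apply: computable_code.
Qed.

Lemma computable_cons {T} {cT : coded T} (x : A -> T) (s : A -> seq T) :
  computable x -> computable s -> computable (fun a => x a :: s a).
Proof.
move=> /computable_code cx /computable_code cs; apply: computable_uncode => /=.
apply: computable_succ; exact: computable_rec2 rec2_npair cx cs.
Qed.

Lemma computable_nilp {T} {cT : coded T} (s : A -> seq T) :
  computable s -> computable (fun a => nilp (s a)).
Proof.
move=> /computable_code cs.
apply: computable_ext (computable_leq cs (computable_const 0)) => a.
by case: (s a).
Qed.

Lemma computable_behead {T} {cT : coded T} (s : A -> seq T) :
  computable s -> computable (fun a => behead (s a)).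
Proof.
move=> /computable_code cs; apply: computable_uncode.
apply: computable_ext (computable_rec1 rec1_nsnd (computable_rec1 rec1_pred cs)) => a.
by case: (s a) => //= x s'; rewrite nsnd_pair.
Qed.

Lemma computable_head {T} {cT : coded T} (x : A -> T) (s : A -> seq T) :
  computable x -> computable s -> computable (fun a => head (x a) (s a)).
Proof.
move=> /computable_code cx cs; apply: computable_uncode.
have cs' := computable_rec1 rec1_nfst (computable_rec1 rec1_pred (computable_code cs)).
apply: computable_ext (computable_if (computable_nilp cs) cx cs') => a.
by case: (s a) => //= y s'; rewrite nfst_pair.
Qed.
End Closure.

(** * Computable operations on lists *)

(** The state pairs the accumulator with the unread rest of the list. It is stationary once the rest
    is empty, so iterating more often than the length is harmless. *)
Lemma computable_foldl {A} {cA : coded A} {S T} {cS : coded S} {cT : coded T}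
    (h : A -> S -> T -> S) (s : A -> S) (l : A -> seq T) :
  computable (fun z : A * S * T => h z.1.1 z.1.2 z.2) ->
  computable s -> computable l -> computable (fun a => foldl (h a) (s a) (l a)).
Proof.
move=> ch cs cl.
pose next a (z : S * seq T) := if z.2 is x :: r then (h a z.1 x, r) else z.
have cz : computable (fun a => iter (code (l a)) (next a) (s a, l a)).
  apply: computable_iter (computable_code cl) _ (computable_pair cs cl).
  case: ch => H rH EH.
  have c1 : computable (fun z : A * (S * seq T) => z.1) by computable_projections.
  have c21 : computable (fun z : A * (S * seq T) => z.2.1) by computable_projections.
  have c22 : computable (fun z : A * (S * seq T) => z.2.2) by computable_projections.
  (* [T] may have no default element for [head], so the first element is extracted on the level of
     codes. *)
  have chd : computable (fun z : A * (S * seq T) => nfst (code z.2.2).-1).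
    exact: computable_rec1 rec1_nfst (computable_rec1 rec1_pred (computable_code c22)).
  have cstep : computable (fun z : A * (S * seq T) => if nilp z.2.2 then code z.2 else
      npair (H (npair (npair (code z.1) (code z.2.1)) (nfst (code z.2.2).-1)))
            (code (behead z.2.2))).
    apply: computable_if; [exact: computable_nilp| |].
      by apply: computable_code; computable_projections.
    apply: computable_rec2 rec2_npair _ (computable_code (computable_behead c22)).
    apply: computable_rec1 => //; apply: computable_rec2 rec2_npair _ chd.
    exact: computable_rec2 rec2_npair (computable_code c1) (computable_code c21).
  apply: computable_uncode; apply: computable_ext cstep.
  case=> a [y [|x r]] //=; rewrite /prod_code /= nfst_pair; congr npair.
  exact: (EH (a, y, x)).
apply: computable_ext (computable_fst cz) => a.
have : size (l a) <= code (l a) by exact: size_seq_code.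
move: (code (l a)) => n; elim: n (s a) (l a) => [|n IHn] y [|x r] //= lt.
  by rewrite -iterS iterSr /= (IHn y [::]).
by rewrite -iterS iterSr /= IHn.
Qed.

Lemma computable_rev {A} {cA : coded A} {T} {cT : coded T} (l : A -> seq T) :
  computable l -> computable (fun a => rev (l a)).
Proof.
move=> cl; have : computable (fun a => foldl (fun r x => x :: r) [::] (l a)).
  apply: computable_foldl cl; last exact: computable_const.
  by apply: computable_cons; computable_projections.
apply: computable_ext => a; rewrite -[l a in LHS]revK foldl_rev.
by elim: (rev (l a)) => //= x s ->.
Qed.

Lemma computable_foldr {A} {cA : coded A} {S T} {cS : coded S} {cT : coded T}
    (h : A -> T -> S -> S) (s : A -> S) (l : A -> seq T) :
  computable (fun z : A * T * S => h z.1.1 z.1.2 z.2) ->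
  computable s -> computable l -> computable (fun a => foldr (h a) (s a) (l a)).
Proof.
move=> ch cs cl.
have : computable (fun a => foldl (fun y x => h a x y) (s a) (rev (l a))).
  apply: computable_foldl (computable_rev cl) => //.
  apply: (computable_comp (g := fun z : A * T * S => h z.1.1 z.1.2 z.2)
    (f := fun z : A * S * T => (z.1.1, z.2, z.1.2))) => //.
  by repeat apply: computable_pair; computable_projections.
by apply: computable_ext => a; rewrite foldl_rev.
Qed.

Lemma computable_cat {A} {cA : coded A} {T} {cT : coded T} (l r : A -> seq T) :
  computable l -> computable r -> computable (fun a => l a ++ r a).
Proof.
move=> cl cr; have : computable (fun a => foldr cons (r a) (l a)).
  by apply: computable_foldr => //; apply: computable_cons; computable_projections.
by apply: computable_ext => a; elim: (l a) => //= x s ->.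
Qed.

Lemma computable_map {A} {cA : coded A} {T U} {cT : coded T} {cU : coded U}
    (h : A -> T -> U) (l : A -> seq T) :
  computable (fun z : A * T => h z.1 z.2) -> computable l ->
  computable (fun a => map (h a) (l a)).
Proof.
move=> ch cl; have : computable (fun a => foldr (fun x r => h a x :: r) [::] (l a)).
  apply: computable_foldr cl; last exact: computable_const.
  apply: computable_cons; last by computable_projections.
  apply: (computable_comp (f := fun z : A * T * seq U => z.1) ch).
  by computable_projections.
by apply: computable_ext => a; elim: (l a) => //= x s ->.
Qed.

Lemma computable_flatten {A} {cA : coded A} {T} {cT : coded T} (l : A -> seq (seq T)) :
  computable l -> computable (fun a => flatten (l a)).
Proof.
move=> cl; apply: (computable_foldr (h := fun _ => cat)) (computable_const [::]) cl.
by apply: computable_cat; computable_projections.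
Qed.

Lemma computable_filter {A} {cA : coded A} {T} {cT : coded T}
    (p : A -> T -> bool) (l : A -> seq T) :
  computable (fun z : A * T => p z.1 z.2) -> computable l ->
  computable (fun a => filter (p a) (l a)).
Proof.
move=> cp cl.
have : computable (fun a => foldr (fun x r => if p a x then x :: r else r) [::] (l a)).
  apply: computable_foldr cl; last exact: computable_const.
  apply: computable_if; last by computable_projections.
    apply: (computable_comp (f := fun z : A * T * seq T => z.1) cp).
    by computable_projections.
  by apply: computable_cons; computable_projections.
by apply: computable_ext => a; elim: (l a) => //= x s ->.
Qed.

Lemma computable_has {A} {cA : coded A} {T} {cT : coded T} (p : A -> T -> bool) (l : A -> seq T) :
  computable (fun z : A * T => p z.1 z.2) -> computable l ->
  computable (fun a => has (p a) (l a)).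
Proof.
move=> cp cl; have := computable_negb (computable_nilp (computable_filter (p := p) cp cl)).
by apply: computable_ext => a; rewrite /nilp size_filter has_count lt0n.
Qed.

Lemma computable_all {A} {cA : coded A} {T} {cT : coded T} (p : A -> T -> bool) (l : A -> seq T) :
  computable (fun z : A * T => p z.1 z.2) -> computable l ->
  computable (fun a => all (p a) (l a)).
Proof.
move=> cp cl; have cnp : computable (fun z : A * T => ~~ p z.1 z.2).
  exact: computable_negb.
apply: computable_ext (computable_negb (computable_has (p := fun a x => ~~ p a x) cnp cl)) => a.
by rewrite -[RHS]negbK -has_predC.
Qed.

Lemma computable_size {A} {cA : coded A} {T} {cT : coded T} (l : A -> seq T) :
  computable l -> computable (fun a => size (l a)).
Proof.
move=> cl; have : computable (fun a => foldr (fun _ n => n.+1) 0 (l a)).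
  apply: computable_foldr cl; last exact: computable_const.
  by apply: computable_succ; computable_projections.
by apply: computable_ext => a; elim: (l a) => //= x s ->.
Qed.

Lemma computable_in {A} {cA : coded A} {T : eqType} {cT : coded T} (x : A -> T) (l : A -> seq T) :
  computable x -> computable l -> computable (fun a => x a \in l a).
Proof.
move=> cx cl; have : computable (fun a => has (fun y => y == x a) (l a)).
  apply: computable_has cl; apply: computable_eq; first by computable_projections.
  by apply: (computable_comp cx); computable_projections.
by apply: computable_ext => a; rewrite has_pred1.
Qed.

Lemma computable_rcons {A} {cA : coded A} {T} {cT : coded T} (l : A -> seq T) (x : A -> T) :
  computable l -> computable x -> computable (fun a => rcons (l a) (x a)).
Proof.
move=> cl cx; have := computable_cat cl (computable_cons cx (computable_const [::])).
by apply: computable_ext => a; rewrite cats1.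
Qed.

Lemma computable_nseq {A} {cA : coded A} {T} {cT : coded T} (n : A -> nat) (x : A -> T) :
  computable n -> computable x -> computable (fun a => nseq (n a) (x a)).
Proof.
move=> cn cx; apply: computable_iter cn _ (computable_const [::]).
apply: computable_cons; last by computable_projections.
by apply: (computable_comp cx); computable_projections.
Qed.

Lemma computable_exp2 {A} {cA : coded A} (n : A -> nat) :
  computable n -> computable (fun a => 2 ^ n a).
Proof.
move=> cn; have : computable (fun a => iter (n a) (fun m => m + m) 1).
  apply: computable_iter cn _ (computable_const 1).
  by apply: computable_rec2 rec2_add _ _; computable_projections.
by apply: computable_ext => a; elim: (n a : nat) => //= m ->; rewrite expnS mul2n addnn.
Qed.

Lemma computable_half_odd {A} {cA : coded A} (n : A -> nat) :
  computable n -> computable (fun a => ((n a)./2, odd (n a))).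
Proof.
move=> cn.
have : computable (fun a => iter (n a)
    (fun z : nat * bool => (if z.2 then z.1.+1 else z.1, ~~ z.2)) (0, false)).
  apply: computable_iter cn _ (computable_const (0, false)).
  apply: computable_pair; last by apply: computable_negb; computable_projections.
  apply: computable_if; last by computable_projections.
    by computable_projections.
  by apply: computable_succ; computable_projections.
apply: computable_ext => a; elim: (n a : nat) => //= m ->.
by rewrite uphalf_half; case: odd.
Qed.

(** * Simulation of machines and the construction *)

Definition config_tuple (c : config) := (cstate c, ctape c, cquery c).
Definition tuple_config (z : nat * (seq nat * seq nat) * seq bool) := Config z.1.1 z.1.2 z.2.
Lemma config_tupleK : cancel config_tuple tuple_config. Proof. by case. Qed.
HB.instance Definition _ := Equality.copy config (can_type config_tupleK).

Lemma config_code_inj : injective (fun c => code (config_tuple c)).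
Proof.
by move=> c d /(@code_inj (nat * (seq nat * seq nat) * seq bool)%type _);
  apply: can_inj config_tupleK _ _.
Qed.
#[export] Instance config_coded : coded config := Coded config_code_inj.

(* Instructions whose move and letter are numbers, so that every number is the code of a
   list of instructions. *)
Definition raw_instruction : Type := ((nat * nat) * (nat * nat * nat * nat))%type.

Definition move_of (m : nat) := if m == 0 then Left else if m == 1 then Stay else Right.
Definition letter_of (u : nat) := if u == 0 then None else Some (u != 1).
Definition instr_of (ins : raw_instruction) : instruction :=
  (ins.1, (ins.2.1.1.1, ins.2.1.1.2, move_of ins.2.1.2, letter_of ins.2.2)).

Lemma instr_of_onto (N : seq instruction) : exists M, map instr_of M = N.
Proof.
pose raw (ins : instruction) : raw_instruction := (ins.1, (ins.2.1.1.1, ins.2.1.1.2,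
  match ins.2.1.2 with Left => 0 | Stay => 1 | Right => 2 end,
  if ins.2.2 is Some b then (b : nat).+1 else 0)).
exists (map raw N); rewrite -map_comp; apply: map_id_in => -[[q a] [[[q' b] m] u]] _.
by rewrite /instr_of /=; congr (_, (_, _, _)); [case: m|case: u => [[]|]].
Qed.

(** This is [write_move] for numeric moves, with projections and tests in place of pattern matching,
    a shape to which the closure lemmas apply. *)
Definition raw_write_move (b m : nat) (t : seq nat * seq nat) : seq nat * seq nat :=
  if m == 0 then (behead t.1, head 0 t.1 :: b :: behead t.2)
  else if m == 1 then (t.1, b :: behead t.2) else (b :: t.1, behead t.2).

Definition fire (c : config) (ins : raw_instruction) : config :=
  Config ins.2.1.1.1 (raw_write_move ins.2.1.1.2 ins.2.1.2 (ctape c))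
    (if ins.2.2 == 0 then cquery c else rcons (cquery c) (ins.2.2 != 1)).

(** The numerals are the reserved states: 1 is [q_query], 2 and 3 are [q_yes] and [q_no], and 4 to 6
    are the halting states. *)
Definition successors (M : seq raw_instruction) (D : pred (seq bool)) (c : config) :=
  if cstate c == 1 then [:: Config (if D (cquery c) then 2 else 3) (ctape c) [::]]
  else if cstate c \in [:: 4; 5; 6] then [::]
  else [seq fire c ins | ins <- M & ins.1 == (cstate c, head 0 (ctape c).2)].

Lemma halted_state c : halted c <-> cstate c \in [:: 4; 5; 6].
Proof.
rewrite !inE; split=> [[o ->]|]; first by case: o.
by case/or3P => /eqP E; [exists Acc|exists Rej|exists Unk].
Qed.

Lemma successorsP M (D : pred (seq bool)) c c' :
  step (map instr_of M) [set w | D w]%classic c c' <-> c' \in successors M D c.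
Proof.
have fireE t q w (ins : raw_instruction) :
  fire (Config q t w) ins = Config ins.2.1.1.1 (write_move ins.2.1.1.2 (move_of ins.2.1.2) t)
    (if letter_of ins.2.2 is Some b then rcons w b else w).
  rewrite /fire /raw_write_move /move_of /letter_of /=; case: t => l r /=.
  by case: (ins.2.1.2 == 0); case: (ins.2.1.2 == 1); case: (ins.2.2 == 0).
split.
  case=> [t w Dw|t w nDw|q t w q' b m u nq nh /mapP[ins IM E]].
  - by rewrite /successors /= Dw inE.
  - by rewrite /successors /= (negbTE (introN idP nDw)) inE.
  rewrite /successors /= ifN ?ifN; last 2 first.
  - apply/negP => /(halted_state (Config q t w))[o]; exact: nh.
  - exact/eqP.
  apply/mapP; exists ins; first by rewrite mem_filter IM andbT; case: E => /esym/eqP.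
  by rewrite fireE; case: E => _ -> -> -> ->.
case: c => q t w; rewrite /successors /=; case: eqP => [->|nq].
  rewrite inE => /eqP ->; case: ifP => [Dw|/negP nDw]; [exact: step_yes|exact: step_no].
case: ifPn => // nh /mapP[ins]; rewrite mem_filter => /andP[/eqP EI IM ->].
rewrite fireE; apply: step_instr => // [o Eo|].
  by case/negP: nh; apply/(halted_state (Config q t w)); exists o.
by rewrite /scanned -[X in (X, _)]EI; apply: (map_f instr_of IM).
Qed.

(** [steps] unfolds at the start of a path, whereas the search [reach] extends paths at their
    end. *)
Lemma steps_last N D k c c' :
  steps N D k.+1 c c' <-> exists2 d, steps N D k c d & step N D d c'.
Proof.
elim: k c => [|k IHk] c.
  by split=> [[d s <-]|[d <- s]]; [exists c|exists c'].
split=> [[d s /IHk[e se s']]|[e [d s se] s']]; first by exists e => //; exists d.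
by exists d => //; apply/IHk; exists e.
Qed.

(** Each round keeps the configurations found before, so that paths halting before time [T] are not
    lost. *)
Definition reach M D T c := iter T (fun s => s ++ flatten (map (successors M D) s)) [:: c].

Lemma reachP M (D : pred (seq bool)) T c c' :
  c' \in reach M D T c <->
  exists2 k, k <= T & steps (map instr_of M) [set w | D w]%classic k c c'.
Proof.
elim: T c' => [|T IHT] c'.
  rewrite /reach inE; split=> [/eqP ->|[k]]; first by exists 0.
  by rewrite leqn0 => /eqP -> /= ->.
rewrite /reach iterS mem_cat; split.
  case/orP => [/IHT[k le s]|/flatten_mapP[d /IHT[k le s] /successorsP s']].
    by exists k => //; apply: leqW.
  by exists k.+1 => //; apply/steps_last; exists d.
case=> -[|k] le s; apply/orP.
  by left; apply/IHT; exists 0.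
right; have [d sd /successorsP sd'] := iffLR (steps_last _ _ _ _ _) s.
by apply/flatten_mapP; exists d => //; apply/IHT; exists k.
Qed.

Definition outputs M D T x o := has (fun c => cstate c == q_halt o) (reach M D T (initial x)).

(** The bound on all paths ensures that cutting the search off at [T] misses no outcome. *)
Lemma outputsP M (D : pred (seq bool)) T x o :
  (forall k c, steps (map instr_of M) [set w | D w]%classic k (initial x) c -> k <= T) ->
  outputs M D T x o <-> out (map instr_of M) [set w | D w]%classic x o.
Proof.
move=> bound; split=> [/hasP[c /reachP[k _ s] /eqP E]|[k [c [s E]]]]; first by exists k, c.
by apply/hasP; exists c; [apply/reachP; exists k => //; apply: bound s|apply/eqP].
Qed.

(** * The oracle and the tally set *)

(* An oracle that differs from the tally default [{0^m | m > 0}] only at the lengths of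
   the words of [L]. *)
Definition oracle (L : seq (seq bool)) (w : seq bool) :=
  (w \in L) || [&& w == nseq (size w) false, 0 < size w & all (fun v => size v != size w) L].

Fixpoint words n : seq (seq bool) :=
  if n is m.+1 then map (cons false) (words m) ++ map (cons true) (words m) else [:: [::]].

Lemma mem_words n w : (w \in words n) = (size w == n).
Proof.
elim: n w => [|n IHn] [|b w] //=.
  by rewrite mem_cat; apply/negbTE/norP; split; apply/mapP => -[].
rewrite eqSS -IHn mem_cat; apply/orP/idP => [[]/mapP[v ? [_ ->]] //|].
by case: b => H; [right|left]; apply: map_f.
Qed.

Lemma uniq_words n : uniq (words n).
Proof.
have cons_inj b : injective (cons b : seq bool -> _) by move=> ? ? [].
elim: n => //= n IHn; rewrite cat_uniq !map_inj_uniq // IHn andbT /=.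
by apply/hasP => -[_ /mapP[v _ ->] /mapP[]].
Qed.

Lemma size_words n : size (words n) = 2 ^ n.
Proof. by elim: n => //= n IHn; rewrite size_cat !size_map IHn expnS mul2n addnn. Qed.

(** Correctness demands acceptance exactly when the last letter is 1 and rejection exactly when it
    is 0, hence [!=] in one disjunct and [==] in the other. *)
Definition errs M L n v :=
  (outputs M (oracle (v :: L)) (2 ^ n) (nseq n false) Acc != last false v)
  || (outputs M (oracle (v :: L)) (2 ^ n) (nseq n false) Rej == last false v).

(** If no word makes the machine err, the choice falls back on the default word of that length. *)
Definition pick_word M L n := head (nseq n.+1 false) [seq v <- words n.+1 | errs M L n v].

Definition stage_length i := iter i (fun m => 2 ^ m) 1.

Lemma stage_onto : code_onto (T := (seq raw_instruction * nat)%type).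
Proof. by do !(apply: prod_code_onto || apply: seq_code_onto); apply: nat_code_onto. Qed.

(** The second component of the decoded pair is only padding, which makes every machine occur at
    infinitely many stages. *)
Definition stage_machine i : seq raw_instruction := (sval (cid (stage_onto i))).1.

Fixpoint history i :=
  if i is j.+1 then pick_word (stage_machine j) (history j) (stage_length j) :: history j
  else [::].

(** Stage [j] adds a word of length greater than [j], so the first [size w] stages already decide
    membership of [w]. *)
Definition diag_oracle w := oracle (history (size w)) w.

Definition diag_tally x := (x == nseq (size x) false) &&
  has (fun w => diag_oracle w && last false w) (words (size x).+1).

(** * Recursiveness of the construction *)

Lemma computable_Config {A} {cA : coded A} (q : A -> nat) (t : A -> seq nat * seq nat)
    (w : A -> seq bool) :
  computable q -> computable t -> computable w -> computable (fun a => Config (q a) (t a) (w a)).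
Proof.
move=> cq ct cw; apply: computable_uncode.
exact: computable_code (computable_pair (computable_pair cq ct) cw).
Qed.

Lemma computable_config_tuple {A} {cA : coded A} (c : A -> config) :
  computable c -> computable (fun a => config_tuple (c a)).
Proof. by move/computable_code => cc; apply: computable_uncode. Qed.

Lemma computable_cstate {A} {cA : coded A} (c : A -> config) :
  computable c -> computable (fun a => cstate (c a)).
Proof. by move/computable_config_tuple/computable_fst/computable_fst. Qed.

Lemma computable_ctape {A} {cA : coded A} (c : A -> config) :
  computable c -> computable (fun a => ctape (c a)).
Proof. by move/computable_config_tuple/computable_fst/computable_snd. Qed.

Lemma computable_cquery {A} {cA : coded A} (c : A -> config) :
  computable c -> computable (fun a => cquery (c a)).
Proof. by move/computable_config_tuple/computable_snd. Qed.

(** The closure lemma is selected by the head symbol of the body. Conditionals are not covered and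
    are treated by hand. *)
Ltac computability := repeat first
  [ assumption | exact: computable_id | exact: computable_const
  | exact: (computable_fst computable_id) | exact: (computable_snd computable_id)
  | lazymatch goal with
    | |- computable (fun a => ((@?x1 a), (@?x2 a))) => apply: computable_pair
    | |- computable (fun a => Config (@?x1 a) (@?x2 a) (@?x3 a)) => apply: computable_Config
    | |- computable (fun a => (@?x1 a) && (@?x2 a)) => apply: computable_and
    | |- computable (fun a => (@?x1 a) || (@?x2 a)) => apply: computable_or
    | |- computable (fun a => ~~ (@?x1 a)) => apply: computable_negb
    | |- computable (fun a => (@?x1 a) == (@?x2 a)) => apply: computable_eq
    | |- computable (fun a => (@?x1 a) \in (@?x2 a)) => apply: computable_in
    | |- computable (fun a => (@?x1 a) <= (@?x2 a)) => apply: computable_leq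
    | |- computable (fun a => (@?x1 a).+1) => apply: computable_succ
    | |- computable (fun a => (@?x1 a) :: (@?x2 a)) => apply: computable_cons
    | |- computable (fun a => rcons (@?x1 a) (@?x2 a)) => apply: computable_rcons
    | |- computable (fun a => behead (@?x1 a)) => apply: computable_behead
    | |- computable (fun a => head (@?x1 a) (@?x2 a)) => apply: computable_head
    | |- computable (fun a => nilp (@?x1 a)) => apply: computable_nilp
    | |- computable (fun a => (@?x1 a) ++ (@?x2 a)) => apply: computable_cat
    | |- computable (fun a => size (@?x1 a)) => apply: computable_size
    | |- computable (fun a => nseq (@?x1 a) (@?x2 a)) => apply: computable_nseq
    | |- computable (fun a => flatten (@?x1 a)) => apply: computable_flatten
    | |- computable (fun a => has (@?x1 a) (@?x2 a)) => apply: computable_has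
    | |- computable (fun a => all (@?x1 a) (@?x2 a)) => apply: computable_all
    | |- computable (fun a => filter (@?x1 a) (@?x2 a)) => apply: computable_filter
    | |- computable (fun a => map (@?x1 a) (@?x2 a)) => apply: computable_map
    | |- computable (fun a => iter (@?x1 a) (@?x2 a) (@?x3 a)) => apply: computable_iter
    | |- computable (fun a => 2 ^ (@?x1 a)) => apply: computable_exp2
    | |- computable (fun a => (@?x1 a).1) => apply: computable_fst
    | |- computable (fun a => (@?x1 a).2) => apply: computable_snd
    | |- computable (fun a => cstate (@?x1 a)) => apply: computable_cstate
    | |- computable (fun a => ctape (@?x1 a)) => apply: computable_ctape
    | |- computable (fun a => cquery (@?x1 a)) => apply: computable_cquery
    end
  | match goal with H : computable ?f |- computable (fun z => ?f _) =>
      apply: (computable_comp (g := f) H) end ].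

Lemma computable_oracle {A} {cA : coded A} (L : A -> seq (seq bool)) (w : A -> seq bool) :
  computable L -> computable w -> computable (fun a => oracle (L a) (w a)).
Proof. by move=> cL cw; rewrite /oracle; computability. Qed.

Lemma computable_fire {A} {cA : coded A} (c : A -> config) (ins : A -> raw_instruction) :
  computable c -> computable ins -> computable (fun a => fire (c a) (ins a)).
Proof.
by move=> cc ci; rewrite /fire /raw_write_move; computability;
  do !(apply: computable_if; computability).
Qed.

Lemma computable_successors {A} {cA : coded A} (M : A -> seq raw_instruction)
    (L : A -> seq (seq bool)) (c : A -> config) :
  computable M -> computable L -> computable c ->
  computable (fun a => successors (M a) (oracle (L a)) (c a)).
Proof.
move=> cM cL cc; rewrite /successors; apply: computable_if; computability.
  apply: computable_if; computability.
  by apply: computable_oracle; computability.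
apply: computable_if; computability.
by apply: computable_fire; computability.
Qed.

Lemma computable_initial {A} {cA : coded A} (x : A -> seq bool) :
  computable x -> computable (fun a => initial (x a)).
Proof. by move=> cx; rewrite /initial /bit_symbol; computability. Qed.

Lemma computable_outputs {A} {cA : coded A} (M : A -> seq raw_instruction)
    (L : A -> seq (seq bool)) (T : A -> nat) (x : A -> seq bool) o :
  computable M -> computable L -> computable T -> computable x ->
  computable (fun a => outputs (M a) (oracle (L a)) (T a) (x a) o).
Proof.
move=> cM cL cT cx; rewrite /outputs /reach; computability.
  by apply: computable_successors; computability.
exact: computable_initial.
Qed.

Lemma computable_words {A} {cA : coded A} (n : A -> nat) :
  computable n -> computable (fun a => words (n a)).
Proof.
move=> cn.
have : computable (fun a => iter (n a)
    (fun s => map (cons false) s ++ map (cons true) s) [:: [::]]).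
  by computability.
by apply: computable_ext => a; elim: (n a) => //= m ->.
Qed.

Lemma computable_last {A} {cA : coded A} (w : A -> seq bool) :
  computable w -> computable (fun a => last false (w a)).
Proof.
move=> cw; have : computable (fun a => head false (rev (w a))).
  by apply: computable_head; [exact: computable_const|exact: computable_rev].
by apply: computable_ext => a; case/lastP: (w a) => // s b; rewrite rev_rcons last_rcons.
Qed.

Lemma computable_pick_word {A} {cA : coded A} (M : A -> seq raw_instruction)
    (L : A -> seq (seq bool)) (n : A -> nat) :
  computable M -> computable L -> computable n ->
  computable (fun a => pick_word (M a) (L a) (n a)).
Proof.
move=> cM cL cn; rewrite /pick_word /errs; computability.
- by apply: computable_outputs; computability.
- by apply: computable_last; computability.
- by apply: computable_outputs; computability.
- by apply: computable_last; computability.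
- by apply: computable_words; computability.
Qed.

Lemma computable_history {A} {cA : coded A} (i : A -> nat) :
  computable i -> computable (fun a => history (i a)).
Proof.
(* The pair decoded from [j] has code [j], so on codes the decoding is the identity. *)
move=> ci; have cmachine : computable stage_machine.
  apply: computable_fst; apply: computable_uncode.
  by apply: computable_ext (computable_id) => j; case: cid.
(* The recursion becomes an iteration whose state also counts the stages. *)
have : computable (fun a => iter (i a) (fun z => (z.1.+1,
    pick_word (stage_machine z.1) z.2 (stage_length z.1) :: z.2)) (0, [::])).
  computability; apply: computable_pick_word; computability.
  by rewrite /stage_length; computability.
move/computable_snd; apply: computable_ext => a.
suff -> m : iter m (fun z => (z.1.+1, pick_word (stage_machine z.1) z.2 (stage_length z.1) :: z.2))
  (0, [::]) = (m, history m) by [].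
by elim: m => //= m ->.
Qed.

Lemma computable_diag_oracle {A} {cA : coded A} (w : A -> seq bool) :
  computable w -> computable (fun a => diag_oracle (w a)).
Proof.
move=> cw; rewrite /diag_oracle; apply: computable_oracle => //.
by apply: computable_history; computability.
Qed.

Lemma computable_diag_tally {A} {cA : coded A} (x : A -> seq bool) :
  computable x -> computable (fun a => diag_tally (x a)).
Proof.
move=> cx; rewrite /diag_tally; computability.
- by apply: computable_diag_oracle; computability.
- by apply: computable_last; computability.
- by apply: computable_words; computability.
Qed.

(* Strips the binary digits of a number, so that it inverts [word_code]. *)
Definition strip (z : nat * seq bool) := if z.1 <= 1 then z else (z.1./2, odd z.1 :: z.2).

(** Digits come off from the right and are put in front of [s]. The leading 1 marks the end and is
    fixed by [strip], so surplus iterations change nothing. *)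
Lemma iter_strip w n s : size w <= n -> iter n strip (word_code w, s) = (1, w ++ s).
Proof.
elim/last_ind: w n s => [|w b IHw] n s; first by elim: n => //= n ->.
rewrite size_rcons; case: n => // n lt; rewrite iterSr /strip /=.
have pos : 0 < word_code w.
  elim/last_ind: (w) => // v c; rewrite /word_code foldl_rcons; lia.
have E : word_code (rcons w b) = (word_code w).*2 + b by rewrite /word_code foldl_rcons.
rewrite E ifN; last by lia.
rewrite addnC half_bit_double oddD odd_double addbF oddb.
by rewrite -/strip IHw // cat_rcons.
Qed.

Lemma size_word_code w : size w <= word_code w.
Proof.
elim/last_ind: w => // w b IHw; rewrite size_rcons /word_code foldl_rcons -/(word_code w).
have : 0 < word_code w by case: (w) IHw => //= c v; lia.
lia.
Qed.

(** [recursive_set] presents a word by [word_code], while [computable] uses its code as a list.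
    Iterating [strip] translates the first into the second. *)
Lemma recursive_set_computable (p : pred (seq bool)) :
  computable p -> recursive_set [set w | p w]%classic.
Proof.
move=> cp; have : computable (fun n => p (iter n strip (n, [::])).2).
  have cs := computable_half_odd (computable_id (A := nat)).
  rewrite /strip; apply: (computable_comp cp); computability.
  have c2 : computable (fun z : nat * (nat * seq bool) => (z.2.1./2, odd z.2.1)).
    by apply: (computable_comp cs); computability.
  have [chalf codd] := (computable_fst c2, computable_snd c2).
  by apply: computable_if; computability.
case=> F rF EF; exists (fun v => F (nth 0 v 0)) => // w.
have -> : F (word_code w) = p (iter (word_code w) strip (word_code w, [::])).2 by exact: EF.
by rewrite (iter_strip _ (size_word_code w)) cats0 asboolb.
Qed.

(** * Correctness *)

Lemma stage_length_mono i j : i < j -> 2 ^ stage_length i <= stage_length j.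
Proof.
elim: j => // j IHj; rewrite ltnS leq_eqVlt => /predU1P[->//|/IHj le].
by apply: leq_trans le _; apply: ltnW; apply: ltn_expl.
Qed.

Lemma ltn_stage_length i : i < stage_length i.
Proof. by elim: i => // i IHi; apply: leq_ltn_trans IHi (ltn_expl _ _). Qed.

Lemma leq_stage_length i j : i <= j -> stage_length i <= stage_length j.
Proof.
rewrite leq_eqVlt => /predU1P[->//|/stage_length_mono]; apply: leq_trans.
exact/ltnW/ltn_expl.
Qed.

Lemma size_pick_word M L n : size (pick_word M L n) = n.+1.
Proof.
rewrite /pick_word; case E : filter => [|v s] /=; first by rewrite size_nseq.
by have := mem_head v s; rewrite -E mem_filter mem_words => /andP[_ /eqP].
Qed.

Lemma size_history i v : v \in history i -> exists2 j, j < i & size v = (stage_length j).+1.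
Proof.
elim: i => // i IHi; rewrite inE => /predU1P[->|/IHi[j lt ->]]; last by exists j => //; apply: ltnW.
by exists i; rewrite ?size_pick_word.
Qed.

Lemma size_history_pick i v :
  v \in history i -> size v != (stage_length i).+1.
Proof.
case/size_history => j lt ->; have := stage_length_mono lt.
by have := ltn_expl (stage_length j) (isT : 1 < 2); rewrite eqSS; lia.
Qed.

(** Each stage adds a word of a length not yet present in the history. *)
Lemma size_history_inj i : {in history i &, injective size}.
Proof.
elim: i => //= i IHi v w; rewrite !inE.
case/predU1P=> [->|vL] /predU1P[->|wL] //; rewrite ?size_pick_word => E; last exact: IHi.
  by have := size_history_pick wL; rewrite E eqxx.
by have := size_history_pick vL; rewrite E eqxx.
Qed.

Lemma oracle_cons v L w : size v != size w -> oracle (v :: L) w = oracle L w.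
Proof.
move=> ne; rewrite /oracle inE /= ne.
by have -> : (w == v) = false by apply: contraNF ne => /eqP ->.
Qed.

(** From stage [i] on, all added words are longer than [stage_length i], and [oracle] depends only
    on the listed words of the length of [w]. *)
Lemma oracle_history_stable i j w :
  i <= j -> size w <= stage_length i -> oracle (history j) w = oracle (history i) w.
Proof.
move=> + lew; elim: j => [|j IHj]; first by rewrite leqn0 => /eqP ->.
rewrite leq_eqVlt => /predU1P[->//|le]; rewrite oracle_cons ?IHj //.
by rewrite size_pick_word neq_ltn ltnS (leq_trans lew) ?orbT // leq_stage_length.
Qed.

Lemma diag_oracleE i w : size w <= stage_length i -> diag_oracle w = oracle (history i) w.
Proof.
move=> lew; have lew' := ltnW (ltn_stage_length (size w)); rewrite /diag_oracle.
by case/orP: (leq_total i (size w)) => le; [|symmetry]; apply: oracle_history_stable.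
Qed.

Lemma diag_oracle_inj w w' : diag_oracle w -> diag_oracle w' -> size w = size w' -> w = w'.
Proof.
rewrite /diag_oracle => Bw Bw' E; move: Bw Bw'; rewrite -E.
case/orP => [wL|/and3P[/eqP dw _ /allP nw]] /orP[w'L|/and3P[/eqP dw' _ /allP nw']].
- exact: size_history_inj wL w'L E.
- by have := nw' w wL; rewrite E eqxx.
- by have := nw w' w'L; rewrite E eqxx.
- by rewrite dw dw' E.
Qed.

(** Either some stage has added a word of this length, or the default word is in place. *)
Lemma diag_oracle_exists n : exists2 w, diag_oracle w & size w = n.+1.
Proof.
have [/hasP[w wL /eqP E]|/hasPn no] := boolP (has (fun w => size w == n.+1) (history n.+1)).
  by exists w => //; rewrite /diag_oracle /oracle E wL.
exists (nseq n.+1 false); last by rewrite size_nseq.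
rewrite /diag_oracle size_nseq; move: (history n.+1) no => L no.
by rewrite /oracle size_nseq eqxx /=; apply/orP; right; apply/allP => v /no.
Qed.

Lemma diag_tallyP n :
  diag_tally (nseq n false) <-> exists w, [/\ size w = n.+1, diag_oracle w & last false w].
Proof.
rewrite /diag_tally size_nseq eqxx andTb; split.
  by case/hasP => w; rewrite mem_words => /eqP sw /andP[]; exists w.
by case=> w [sw Bw lw]; apply/hasP; exists w; rewrite ?mem_words ?sw // Bw.
Qed.

(** * Dependence of a path on its queries *)

(** [Q] lists the words queried along the path. A step appends at most one letter to the query tape
    and a query takes a step itself, whence the strict bound on their lengths. *)
Lemma steps_queries N D k c c' : steps N D k c c' ->
  exists Q, [/\ size Q <= k, {in Q, forall w, size w < size (cquery c) + k} &
    forall D', {in Q, forall w, D' w <-> D w} -> steps N D' k c c'].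
Proof.
elim: k c => [|k IHk] c /=; first by move=> <-; exists [::].
case=> d s /IHk[Q [szQ shortQ agreeQ]].
case: s Q szQ shortQ agreeQ => [t w Dw|t w nDw|q t w q' b m u nq nh ins] Q szQ shortQ agreeQ.
- exists (w :: Q); split=> //.
    by move=> v; rewrite inE => /predU1P[->|/shortQ] /=; lia.
  move=> D' agree; exists (Config q_yes t [::]).
    by apply: step_yes; apply/agree => //; rewrite mem_head.
  by apply: agreeQ => v vQ; apply: agree; rewrite inE vQ orbT.
- exists (w :: Q); split=> //.
    by move=> v; rewrite inE => /predU1P[->|/shortQ] /=; lia.
  move=> D' agree; exists (Config q_no t [::]).
    by apply: step_no => D'w; apply/nDw/agree; rewrite ?mem_head.
  by apply: agreeQ => v vQ; apply: agree; rewrite inE vQ orbT.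
exists Q; split=> [||D' agree]; first exact: leqW.
  by move=> v /shortQ /=; case: (u) => [a|]; rewrite /= ?size_rcons; lia.
by exists (Config q' (write_move b m t) (if u is Some a then rcons w a else w));
  [apply: step_instr|apply: agreeQ].
Qed.

(** Without an outcome every path could be prolonged, in the end beyond the polynomial bound. *)
Lemma nptm_out N D x : nptm N -> exists o, out N D x o.
Proof.
case=> p bound; apply: contrapT => none.
have /(_ p.[size x].+1)%R [c /bound[]] : forall k, exists c, steps N D k (initial x) c.
  elim=> [|k [c s]]; first by exists (initial x).
  have [_ [[o E]|[d s']]] := bound _ _ _ _ s; first by case: none; exists o, k, c.
  by exists d; apply/steps_last; exists c.
by rewrite ltnn.
Qed.

Lemma out_queries N (p : nat) D x o :
  (forall k c, steps N D k (initial x) c -> k <= p) -> out N D x o ->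
  exists Q, [/\ size Q <= p, {in Q, forall w, size w < p} &
    forall D', {in Q, forall w, D' w <-> D w} -> out N D' x o].
Proof.
move=> bound [k [c [s E]]]; have le := bound _ _ s.
have [Q [szQ shortQ agreeQ]] := steps_queries s.
exists Q; split=> [|w /shortQ lt|D' /agreeQ s']; [exact: leq_trans le|exact: leq_trans le|].
by exists k, c.
Qed.

(** * Exponential against polynomial growth *)

Lemma exp_dominates c d : exists n0, forall n, n0 <= n -> c * n.+1 ^ d < 2 ^ n.
Proof.
(* This threshold makes the quotient [m] of [n] by [d.+1] at least [c * d.+1 ^ d]. That constant is
   then absorbed into one more factor [m.+1], and [m.+1 <= 2 ^ m] is raised to the power [d.+1]. *)
exists (d.+1 * (c * d.+1 ^ d)) => n le.
pose m := n %/ d.+1.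
have le_n : n.+1 <= d.+1 * m.+1 by rewrite mulnC ltn_ceil.
have le_m : c * d.+1 ^ d <= m by rewrite /m leq_divRL // mulnC.
apply: (@leq_ltn_trans (c * (d.+1 * m.+1) ^ d)).
  rewrite leq_mul2l; apply/orP; right.
  by case: (posnP d) => [->|d_gt0]; rewrite ?expn0 ?leq_exp2r.
rewrite expnMn mulnA.
apply: (@leq_trans (m.+1 * m.+1 ^ d)); first by rewrite ltn_mul2r expn_gt0.
rewrite -expnS; apply: (@leq_trans ((2 ^ m) ^ d.+1)).
  by rewrite leq_exp2r // ltn_expl.
by rewrite -expnM leq_exp2l // leq_divM.
Qed.

(** In a Horner step the degree grows by one and the new coefficient is added to [c], since powers
    of [n.+1] are positive. *)
Lemma poly_nat_bound (p : {poly nat}) : exists c d, forall n, p.[n]%R <= c * n.+1 ^ d.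
Proof.
elim/poly_ind: p => [|p a [c [d IHp]]]; first by exists 0, 0 => n; rewrite horner0.
exists (c + a), d.+1 => n; rewrite hornerMXaddC.
have := IHp n; rewrite -[(_ + _)%R]/(p.[n]%R * n + a) => le.
have pos : 0 < n.+1 ^ d by rewrite expn_gt0.
rewrite expnS mulnDl; apply: leq_add; last first.
  by rewrite leq_pmulr // muln_gt0.
by rewrite mulnCA mulnC; apply: leq_mul => //; apply: leqnSn.
Qed.

(** The product bounds the total number of queries on [p.[n].+1] paths of length at most [p.[n]], as
    needed against robust underproductivity. *)
Lemma exp_dominates_poly (p : {poly nat}) :
  exists n0, forall n, n0 <= n -> p.[n]%R * p.[n].+1%R < 2 ^ n.
Proof.
have [c [d le_p]] := poly_nat_bound p.
have [n0 lt] := exp_dominates (c * c.+1) (d + d); exists n0 => n /lt; apply: leq_ltn_trans.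
have := le_p n; have : 0 < n.+1 ^ d by rewrite expn_gt0.
move: p.[n]%R => v; rewrite expnD; move: (_ ^ d) => e pos le.
rewrite mulnACA; apply: leq_mul => //; rewrite mulSn; lia.
Qed.

(** Padding [M] with [n0] gives a stage number at least [n0], and stage lengths exceed their
    index. *)
Lemma stage_exists M n0 : exists2 i, stage_machine i = M & n0 <= stage_length i.
Proof.
have [i Ei] : exists i, i = code (M, n0) by eexists.
exists i.
  rewrite /stage_machine; case: cid => z Ez; rewrite [sval _]/=.
  by have -> : z = (M, n0) by apply: code_inj; rewrite Ez Ei.
apply: leq_trans (ltnW (ltn_stage_length i)); rewrite Ei.
exact: (npair_ge (code M) n0).2.
Qed.

(** * The guessing machine *)

(* Guesses a word of length [n.+1] on input [0^n], remembering its last letter on the tape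
   while querying it, and rejects any input that contains a 1. *)
Definition guess_rules : seq raw_instruction :=
  [:: ((0, 1), (0, 1, 2, 1)); ((0, 1), (0, 1, 2, 2)); ((0, 2), (5, 2, 1, 0));
      ((0, 0), (1, 1, 1, 1)); ((0, 0), (1, 2, 1, 2));
      ((2, 1), (5, 1, 1, 0)); ((2, 2), (4, 2, 1, 0));
      ((3, 1), (6, 1, 1, 0)); ((3, 2), (6, 2, 1, 0)) ].
(** In the rules, tape symbols 1 and 2 are the letters 0 and 1, moves 1 and 2 are [Stay] and
    [Right], and a final entry 0, 1 or 2 appends nothing, the letter 0 or the letter 1. *)
Definition guess_machine := map instr_of guess_rules.

Lemma step_guess D c d :
  step guess_machine D c d <-> d \in successors guess_rules (fun w => `[< D w >]) c.
Proof.
rewrite -successorsP; suff -> : [set w | `[< D w >]]%classic = D by [].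
by apply/funext => w; rewrite /= asboolE.
Qed.

(** This is [out] with an arbitrary starting configuration, as the inductions along the input
    require. *)
Definition halts_with N D c o := exists k c', steps N D k c c' /\ cstate c' = q_halt o.

Lemma halts_with_halted N D c o : halted c -> halts_with N D c o <-> cstate c = q_halt o.
Proof.
move=> hc; split=> [[[|k] [c' [s E]]]|E]; last by exists 0, c.
  by rewrite s.
case: s => d s _; case: s hc => [t w _|t w _|q t w q' b m u _ nh _] hc.
- by case: hc => -[].
- by case: hc => -[].
by case: hc => o' /nh.
Qed.

Lemma halts_with_step N D c o : ~ halted c ->
  halts_with N D c o <-> exists2 d, step N D c d & halts_with N D d o.
Proof.
move=> nh; split=> [[[|k] [c' [s E]]]|[d s [k [c' [ss E]]]]].
- by case: nh; exists o; rewrite s.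
- by case: s => d s ss; exists d => //; exists k, c'.
by exists k.+1, c'; split=> //; exists d.
Qed.

Lemma halted_halt o t w : halted (Config (q_halt o) t w). Proof. by exists o. Qed.
#[local] Hint Resolve halted_halt : core.

Definition runs_within N D c T := forall k c', steps N D k c c' ->
  k <= T /\ (halted c' \/ exists d, step N D c' d).

Lemma runs_within_halted N D c T : halted c -> runs_within N D c T.
Proof.
move=> hc [|k] c' /=; first by move=> <-; split; [|left].
case=> d s _; case: s hc => [t w _|t w _|q t w q' b m u _ nh _] hc.
- by case: hc => -[].
- by case: hc => -[].
by case: hc => o /nh.
Qed.

Lemma runs_within_step N D c T : (exists d, step N D c d) ->
  (forall d, step N D c d -> runs_within N D d T) -> runs_within N D c T.+1.
Proof.
move=> go next [|k] c' /=; first by move=> <-; split; [|right].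
case=> d s ss.
by have [] := next d s k c' ss; split.
Qed.

Section GuessRuns.
Variable D : set (seq bool).
Local Notation succ c := (successors guess_rules (fun w => `[< D w >]) c).
Local Notation halts c o := (halts_with guess_machine D c o).

Lemma halts_next1 c d o : ~ halted c -> succ c = [:: d] -> halts c o <-> halts d o.
Proof.
move=> nh E; rewrite halts_with_step //; split=> [[e]|h].
  by rewrite step_guess E inE => /eqP ->.
by exists d => //; rewrite step_guess E mem_head.
Qed.

Lemma halts_next2 c d e o : ~ halted c -> succ c = [:: d; e] ->
  halts c o <-> halts d o \/ halts e o.
Proof.
move=> nh E; rewrite halts_with_step //; split=> [[f]|[h|h]].
- by rewrite step_guess E !inE => /orP[] /eqP ->; [left|right].
- by exists d => //; rewrite step_guess E mem_head.
by exists e => //; rewrite step_guess E !inE eqxx orbT.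
Qed.

Lemma runs_next c d s T : succ c = d :: s ->
  {in d :: s, forall e, runs_within guess_machine D e T} -> runs_within guess_machine D c T.+1.
Proof.
move=> E next; apply: runs_within_step; first by exists d; rewrite step_guess E mem_head.
by move=> e; rewrite step_guess E => /next.
Qed.

Lemma not_halted_state (q : nat) t w : q \notin [:: 4; 5; 6] -> ~ halted (Config q t w).
Proof. by move=> nq /halted_state /=; rewrite (negbTE nq). Qed.

Definition guess_outcome v b := if `[< D v >] then (if b then Acc else Rej) else Unk.

Lemma succ_query l b v : succ (Config 1 (l, [:: bit_symbol b]) v) =
  [:: Config (if `[< D v >] then 2 else 3) (l, [:: bit_symbol b]) [::]].
Proof. by []. Qed.

Lemma succ_answer l b v :
  succ (Config (if `[< D v >] then 2 else 3) (l, [:: bit_symbol b]) [::]) =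
  [:: Config (q_halt (guess_outcome v b)) (l, [:: bit_symbol b]) [::]].
Proof. by rewrite /guess_outcome; case: asboolP; case: b. Qed.

Lemma halts_query l b v o :
  halts (Config 1 (l, [:: bit_symbol b]) v) o <-> o = guess_outcome v b.
Proof.
rewrite (halts_next1 _ _ (succ_query l b v)); last exact: not_halted_state.
rewrite (halts_next1 _ _ (succ_answer l b v)); last first.
  by apply: not_halted_state; case: asboolP.
rewrite halts_with_halted //=; split=> [|->//].
by case: o; case: guess_outcome.
Qed.

(** [w] is the part guessed so far. Each remaining input letter contributes one guessed letter and
    the blank behind the input one more, hence [n.+1]. *)
Lemma halts_tally n l w o : halts (Config 0 (l, map bit_symbol (nseq n false)) w) o <->
  exists2 v, size v = n.+1 & o = guess_outcome (w ++ v) (last false v).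
Proof.
elim: n l w => [|n IHn] l w.
  rewrite (@halts_next2 _ (Config 1 (l, [:: bit_symbol false]) (rcons w false))
    (Config 1 (l, [:: bit_symbol true]) (rcons w true))) //; last exact: not_halted_state.
  rewrite !halts_query -!cats1; split=> [[->|->]|]; [by exists [:: false]|by exists [:: true]|].
  by case=> -[|[] []] // _ ->; [right|left].
rewrite (@halts_next2 _ (Config 0 (1 :: l, map bit_symbol (nseq n false)) (rcons w false))
  (Config 0 (1 :: l, map bit_symbol (nseq n false)) (rcons w true))) //;
  last exact: not_halted_state.
rewrite !IHn; split.
  by case=> -[v sv ->]; [exists (false :: v)|exists (true :: v)]; rewrite /= ?sv // cat_rcons;
     case: v sv.
case=> -[|b v] //= [sv] ->; case: b; [right|left]; exists v => //; rewrite cat_rcons;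
  by case: v sv.
Qed.

Lemma halts_nontally x l w o : true \in x ->
  halts (Config 0 (l, map bit_symbol x) w) o <-> o = Rej.
Proof.
elim: x l w => //= -[] x IHx l w.
  move=> _; rewrite (@halts_next1 _ (Config (q_halt Rej) (l, map bit_symbol (true :: x)) w)) //;
    last exact: not_halted_state.
  by rewrite halts_with_halted //; case: (o); split.
rewrite inE /= => xT.
rewrite (@halts_next2 _ (Config 0 (1 :: l, map bit_symbol x) (rcons w false))
  (Config 0 (1 :: l, map bit_symbol x) (rcons w true))) //; last exact: not_halted_state.
by rewrite !IHx //; tauto.
Qed.

(** The three additional steps are the guess at the blank, the query and the transition to a halting
    state. *)
Lemma guess_runs_within x l w :
  runs_within guess_machine D (Config 0 (l, map bit_symbol x) w) (size x + 3).
Proof.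
have query l' b v : runs_within guess_machine D (Config 1 (l', [:: bit_symbol b]) v) 2.
  apply: runs_next (succ_query l' b v) _ => _ /[1!inE] /eqP ->.
  apply: runs_next (succ_answer l' b v) _ => _ /[1!inE] /eqP ->.
  exact: runs_within_halted.
elim: x l w => [|[] x IHx] l w.
- apply: (@runs_next _ (Config 1 (l, [:: bit_symbol false]) (rcons w false))
    [:: Config 1 (l, [:: bit_symbol true]) (rcons w true)]) => // e.
  by rewrite !inE => /orP[] /eqP ->; apply: query.
- rewrite addSn; apply: (@runs_next _ (Config (q_halt Rej) (l, map bit_symbol (true :: x)) w)
    [::]) => // e; rewrite inE => /eqP ->; exact: runs_within_halted.
rewrite addSn; apply: (@runs_next _ (Config 0 (1 :: l, map bit_symbol x) (rcons w false))
  [:: Config 0 (1 :: l, map bit_symbol x) (rcons w true)]) => // e.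
by rewrite !inE => /orP[] /eqP ->; apply: IHx.
Qed.
End GuessRuns.

Lemma nptm_guess : nptm guess_machine.
Proof.
exists ('X + 3%:P)%R => D x k c s; rewrite hornerD hornerX hornerC.
exact: (guess_runs_within s).
Qed.

Lemma tally_dichotomy x : x = nseq (size x) false \/ true \in x.
Proof. by elim: x => [|[] x [E|]]; [left|right|right|left; rewrite /= -E|right; rewrite inE]. Qed.

Definition diag_oracle_set : set (seq bool) := [set w | diag_oracle w]%classic.
Definition diag_tally_set : set (seq bool) := [set w | diag_tally w]%classic.

Lemma out_guess_tally n o : out guess_machine diag_oracle_set (nseq n false) o <->
  exists2 v, size v = n.+1 & o = guess_outcome diag_oracle_set v (last false v).
Proof. exact: halts_tally. Qed.

(** Exactly one word of length [n.+1] is in the oracle. The path guessing it accepts or rejects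
    according to its last letter, and all others end in [Unk]. *)
Lemma guess_SN : SN_via guess_machine diag_tally_set diag_oracle_set.
Proof.
have outE v : guess_outcome diag_oracle_set v (last false v) =
  if diag_oracle v then if last false v then Acc else Rej else Unk.
  by rewrite /guess_outcome asboolb.
split; first exact: nptm_guess.
- move=> x; have [->|xT] := tally_dichotomy x; last first.
    by move=> E; have : [set Unk]%classic Rej by rewrite -E; apply/halts_nontally.
  move=> E; have [w Bw sw] := diag_oracle_exists (size x).
  have : [set Unk]%classic (if last false w then Acc else Rej).
    by rewrite -E; apply/out_guess_tally; exists w; rewrite // outE Bw.
  by case: last.
- move=> x; have [->|xT] := tally_dichotomy x; last first.
    by move/(_ Acc (or_introl erefl))/(halts_nontally _ _ _ _ xT).
  move=> sub; have /out_guess_tally[v sv] := sub Acc (or_introl erefl).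
  have /out_guess_tally[w sw] := sub Rej (or_intror erefl).
  rewrite !outE; case: ifP => // Bw; case: ifP => // lw _; case: ifP => // Bv; case: ifP => // lv _.
  by move: lw; rewrite (diag_oracle_inj Bw Bv) ?lv ?sw ?sv.
apply/seteqP; split=> x; rewrite /lang /=.
  have [->|xT] := tally_dichotomy x; last first.
    by case/andP => /eqP E; move: xT; rewrite E mem_nseq andbF.
  case/diag_tallyP => w [sw Bw lw]; apply/out_guess_tally.
  by exists w; rewrite // outE Bw lw.
have [->|xT] := tally_dichotomy x; last by move/(halts_nontally _ _ _ _ xT).
case/out_guess_tally => v sv; rewrite outE.
case: ifP => // Bv; case: ifP => // lv _.
by apply/diag_tallyP; exists v.
Qed.

Lemma tally_diag_tally : tally_set diag_tally_set.
Proof. by move=> x /andP[/eqP -> _]; exists (size x). Qed.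

(** A member is determined by its length, so those of length at most [n] lie in the image under [g]
    of the [n.+1] possible lengths. *)
Lemma sparse_diag_oracle : sparse_set diag_oracle_set.
Proof.
have /choice[g gP] : forall n, exists w, forall v, diag_oracle v -> size v = n -> v = w.
  case=> [|n]; first by exists [::] => v _ /size0nil.
  have [w Bw sw] := diag_oracle_exists n; exists w => v Bv sv.
  by apply: diag_oracle_inj; rewrite ?sw.
exists ('X + 1%:P)%R => n; rewrite hornerD hornerX hornerC.
apply: card_le_trans (card_image_le g _); apply: subset_card_le => v [Bv /= le].
by exists (size v); [rewrite /= [(_ + _)%R]addn1 ltnS|rewrite -(gP _ v)].
Qed.

(** * The diagonalization argument *)

Lemma pigeonhole (b : bool) (W Q : seq (seq bool)) :
  uniq W -> size Q < size W -> exists2 w, w \in W & rcons w b \notin Q.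
Proof.
move=> uW lt; apply: contrapT => none.
have : size (map (rcons^~ b) W) <= size Q.
  apply: uniq_leq_size; first by rewrite map_inj_uniq // => ? ? /rcons_inj[].
  move=> _ /mapP[w wW ->]; apply: contrapT => /negP nQ.
  by apply: none; exists w.
by rewrite size_map leqNgt lt.
Qed.

Lemma size_flatten_map_leq (f : seq bool -> seq (seq bool)) p W :
  {in W, forall w, size (f w) <= p} -> size (flatten (map f W)) <= p * size W.
Proof.
elim: W => //= w W IHW le; rewrite size_cat mulnS leq_add ?le ?mem_head //.
by apply: IHW => v vW; apply: le; rewrite inE vW orbT.
Qed.

Lemma errsP M L n v (N := map instr_of M) (D := [set w | oracle (v :: L) w]%classic)
    (x := nseq n false) :
  (forall k c, steps N D k (initial x) c -> k <= 2 ^ n) -> ~~ errs M L n v ->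
  (out N D x Acc <-> last false v) /\ (out N D x Rej <-> ~~ last false v).
Proof.
move=> bound; rewrite /errs negb_or negbK => /andP[/eqP EA ER].
rewrite -!(outputsP _ bound) EA; split=> //.
by move: ER; case: outputs; case: last.
Qed.

Lemma oracle_cons_eq v L w :
  {in L, forall u, size u != size v} -> size w = size v -> oracle (v :: L) w = (w == v).
Proof.
move=> nL E; rewrite /oracle inE /= E eqxx /= !andbF orbF.
by have [/nL|_] := boolP (w \in L); rewrite ?orbF // E eqxx.
Qed.

Section Diagonalization.
Variables (N : seq instruction) (M : seq raw_instruction).
Hypothesis EM : map instr_of M = N.
Hypothesis SN : SN_via N diag_tally_set diag_oracle_set.
Variables (i p : nat).
Let n := stage_length i.
Let x := nseq n false.
Let L := history i.
Hypothesis machine_i : stage_machine i = M.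
Hypothesis bound : forall D k c, steps N D k (initial x) c -> k <= p.
Hypothesis lt_p : p * p.+1 < 2 ^ n.

Let with_word v : set (seq bool) := [set w | oracle (v :: L) w]%classic.

Let lt_p1 : p < 2 ^ n.
Proof. by apply: leq_ltn_trans lt_p; rewrite leq_pmulr. Qed.

(** Queries of [N] on [x] are shorter than [2 ^ n], where the final oracle equals that of stage [i].
    So the simulation shows the true outcomes, which are correct because [N] reduces the tally
    set. *)
Lemma pick_word_correct : ~~ errs M L n (pick_word M L n).
Proof.
set v := pick_word M L n.
have [nN oN uN EA] := SN.
have hist1 : history i.+1 = v :: L by rewrite /= machine_i.
(* The bound [2 ^ n] is [stage_length i.+1], below which the history up to stage [i] is final. *)
have agree w : size w <= 2 ^ n -> diag_oracle_set w <-> with_word v w.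
  by move=> le; rewrite /diag_oracle_set /with_word /= (@diag_oracleE i.+1) // hist1.
have Bv : diag_oracle v.
  have lev : size v <= 2 ^ n by rewrite size_pick_word ltn_expl.
  by apply/(agree v lev); rewrite /with_word /= /oracle mem_head.
have outE o : out N diag_oracle_set x o <-> out N (with_word v) x o.
  split=> /(out_queries (@bound _))[Q [_ short]]; apply=> w /short lt;
    have le : size w <= 2 ^ n by [exact/ltnW/(ltn_trans lt)].
    by split=> /agree; apply.
  exact: agree.
have AccE : out N diag_oracle_set x Acc <-> last false v.
  rewrite -[out _ _ _ _]/(lang N diag_oracle_set x) -EA /diag_tally_set /= diag_tallyP.
  split=> [[w [sw Bw lw]]|lv]; last by exists v; rewrite size_pick_word.
  by rewrite (diag_oracle_inj Bv Bw) // size_pick_word sw.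
have RejE : out N diag_oracle_set x Rej <-> ~~ last false v.
  split=> [outR|nlv].
    by apply/negP => /AccE outA; apply: (uN x) => o [] ->.
  (* With neither [Acc] nor [Rej], the outcome that must exist is [Unk] alone, against
     overproductivity. *)
  apply: contrapT => nR; apply: (oN x).
  have nA : ~ out N diag_oracle_set x Acc by move=> /AccE; apply/negP.
  have [o oo] := nptm_out diag_oracle_set x nN.
  by apply/seteqP; split=> [[] //|_ ->]; case: o oo.
have outputsE o : outputs M (oracle (v :: L)) (2 ^ n) x o <-> out N diag_oracle_set x o.
  by rewrite outE outputsP EM // => k c /bound le; apply: leq_trans (ltnW lt_p1).
rewrite /errs negb_or negbK; apply/andP; split.
  by apply/eqP; apply/idP/idP => [/outputsE/AccE|/AccE/outputsE].
apply/negP => /eqP E; have := outputsE Rej; rewrite E RejE.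
by case: last => -[h1 h2]; [have := h1 isT|have := h2 isT].
Qed.

(** An erring word would have been chosen if there were one. The chosen word does not err, so the
    list of erring words is empty. *)
Lemma stage_correct v : size v = n.+1 ->
  (out N (with_word v) x Acc <-> last false v) /\ (out N (with_word v) x Rej <-> ~~ last false v).
Proof.
move=> sv; rewrite -EM; apply: errsP.
  by move=> k c; rewrite EM => /bound le; apply: leq_trans (ltnW lt_p1).
have := pick_word_correct; rewrite /pick_word.
case E : filter => [|u s] /=; last first.
  by have := mem_head u s; rewrite -E mem_filter => /andP[->].
move=> _; apply/negP => ev; have : v \in [::] by rewrite -E mem_filter ev mem_words sv eqxx.
by [].
Qed.

(** The condition on the size removes the default word of length [n.+1], which [oracle L]
    contains. *)
Let without : set (seq bool) := [set w | (size w != n.+1) && oracle L w]%classic.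

Lemma with_wordE v w : size v = n.+1 -> with_word v w <-> without w \/ w = v.
Proof.
move=> sv; rewrite /with_word /without /=.
have [sw|nw] := eqVneq (size w) n.+1.
  rewrite oracle_cons_eq ?sw //; first by split=> [/eqP|[] // ->]; [right|].
  by move=> u uL; rewrite sv; apply: size_history_pick.
rewrite oracle_cons ?sv ?(eq_sym n.+1) //=; split=> [|[] // E]; first by left.
by rewrite E sv eqxx in nw.
Qed.

Lemma not_overproductive : ~ robustly_overproductive N.
Proof.
move=> /(_ without x) over; have [nN _ _ _] := SN.
(* The letter [b] is the one for which the outcome [o] is wrong: 0 for acceptance, 1 for
   rejection. *)
have [b [o [oo wrong]]] : exists b o, out N without x o /\
    forall v, size v = n.+1 -> last false v = b -> ~ out N (with_word v) x o.
  have [outA|nA] := pselect (out N without x Acc).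
    exists false, Acc; split=> // v /stage_correct[AE _] lv.
    by rewrite AE lv.
  have [outR|nR] := pselect (out N without x Rej).
    exists true, Rej; split=> // v /stage_correct[_ RE] lv.
    by rewrite RE lv.
  case: over; have [o oo] := nptm_out without x nN.
  by apply/seteqP; split=> [[] //|_ ->]; case: o oo.
have [Q [szQ _ agree]] := out_queries (@bound _) oo.
(* There are [2 ^ n] words of length [n.+1] ending in [b], more than the path can query. *)
have [|w] := @pigeonhole b (words n) Q (uniq_words n).
  by rewrite size_words (leq_ltn_trans szQ).
rewrite mem_words => /eqP sw nQ; have srw : size (rcons w b) = n.+1 by rewrite size_rcons sw.
apply: (wrong (rcons w b)); rewrite ?last_rcons //; apply: agree => u uQ.
rewrite with_wordE //; split=> [[//|E]|]; last by left.
by rewrite -E uQ in nQ.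
Qed.

(* The accepting and rejecting paths for different added words coexist in one oracle as soon
   as neither path queries the word added for the other: the [p.+1] rejecting paths for the
   words of [W] leave some [w'] unqueried, and the accepting path for [w'] misses a word of
   [W]. *)
Lemma not_underproductive : ~ robustly_underproductive N.
Proof.
move=> under.
have correct w (b : bool) : size w = n -> exists Q, size Q <= p /\
    forall D', {in Q, forall u, D' u <-> with_word (rcons w b) u} ->
      out N D' x (if b then Acc else Rej).
  move=> sw; have [|AE RE] := @stage_correct (rcons w b); first by rewrite size_rcons sw.
  have : out N (with_word (rcons w b)) x (if b then Acc else Rej).
    by case: b AE RE => AE RE; [apply/AE|apply/RE]; rewrite last_rcons.
  by case/(out_queries (@bound _)) => Q [szQ _ agree]; exists Q.
have /choice[f fP] : forall w, exists Q, size w = n -> size Q <= p /\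
    forall D', {in Q, forall u, D' u <-> with_word (rcons w false) u} -> out N D' x Rej.
  move=> w; have [sw|nsw] := eqVneq (size w) n; last by exists [::] => E; rewrite E eqxx in nsw.
  by have [Q QP] := correct w false sw; exists Q.
pose W := take p.+1 (words n).
have szW : size W = p.+1 by rewrite size_takel ?size_words.
have WP : {in W, forall w, size w = n} by move=> w /mem_take; rewrite mem_words => /eqP.
have [|w'] := @pigeonhole true (words n) (flatten (map f W)) (uniq_words n).
  (* The rejecting paths make at most [p * p.+1] queries altogether, fewer than the [2 ^ n]
     candidates for [w']. *)
  rewrite size_words; apply: leq_ltn_trans lt_p; rewrite -szW.
  by apply: size_flatten_map_leq => w /WP/fP[].
rewrite mem_words => /eqP sw' w'Q; have [Q [szQ agreeQ]] := correct w' true sw'.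
have [||w wW wQ] := @pigeonhole false W Q; first exact: take_uniq (uniq_words n).
  by rewrite szW.
have [_ agreef] := fP w (WP w wW).
pose D' : set (seq bool) := [set u | without u \/ u = rcons w false \/ u = rcons w' true]%classic.
have D'_out : out N D' x Acc /\ out N D' x Rej.
  split; [apply: agreeQ|apply: agreef] => u uQ; rewrite with_wordE ?size_rcons ?sw' ?WP // /D' /=.
    split=> [[|[E|]]|[]]; [by left| |by right|by left|by right; right].
    by rewrite -E uQ in wQ.
  split=> [[|[|E]]|[]]; [by left|by right| |by left|by right; left].
  by case/negP: w'Q; rewrite -E; apply/flatten_mapP; exists w.
by apply: (under D' x) => o [] ->; case: D'_out.
Qed.
End Diagonalization.

Lemma diagonalization N : SN_via N diag_tally_set diag_oracle_set ->
  ~ robustly_overproductive N /\ ~ robustly_underproductive N.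
Proof.
move=> SN; have [M EM] := instr_of_onto N; have [[p bound] _ _ _] := SN.
have [n0 lt] := exp_dominates_poly p; have [i machine_i le] := stage_exists M n0.
have bound_i D k c : steps N D k (initial (nseq (stage_length i) false)) c ->
    k <= p.[stage_length i]%R.
  by case/bound; rewrite size_nseq.
by split; [apply: (not_overproductive EM SN machine_i bound_i (lt _ le))
          |apply: (not_underproductive EM SN machine_i bound_i (lt _ le))].
Qed.

Theorem theorem4p2 :
  (exists A B : language,
     [/\ recursive_set A /\ tally_set A, recursive_set B /\ sparse_set B,
         SN_reducible A B & ~ O_reducible A B]) /\
  (exists A B : language,
     [/\ recursive_set A /\ tally_set A, recursive_set B /\ sparse_set B,
         SN_reducible A B & ~ U_reducible A B]).
Proof.
have recA := recursive_set_computable (computable_diag_tally computable_id).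
have recB := recursive_set_computable (computable_diag_oracle computable_id).
have SN : SN_reducible diag_tally_set diag_oracle_set by exists guess_machine; apply: guess_SN.
split; exists diag_tally_set, diag_oracle_set; split=> //;
  try (split=> //; (exact: tally_diag_tally || exact: sparse_diag_oracle)).
- by case=> N /diagonalization[].
- by case=> N /diagonalization[].
Qed.
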